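(* (a) Let $M$ be a cone that is strongly unitarily closed (relative to the class of all cones). Then $M$ is a refinement cone. (b) Let $M$ be a cone that is unitarily closed (relative to the class of all cones). Then $M$ is normally divisible, i.e., for every positive integer $p$, every finite subset $X$ of $M$ and every $a\in M$, there exists $u\in M$ such that $pu=a$ and, for all $x,y\in X$, $x+a=y+a$ implies $x+u=y+u$.
   Context: Commutative monoids are written additively. The algebraic preordering of a commutative monoid $M$ is $x\le y\iff(\exists z\in M)(x+z=y)$. A cone is a commutative monoid that is conical: $x+y=0\Rightarrow x=y=0$. A refinement cone is a cone with the refinement property: whenever $a_0+a_1=b_0+b_1$ there are $c_{ij}$ ($i,j<2$) with $a_i=c_{i0}+c_{i1}$ and $b_i=c_{0i}+c_{1i}$ for all $i<2$. A homomorphism $f:A\to B$ of commutative monoids is unitary if it is one-to-one, has cofinal image (every $b\in B$ satisfies $b\le f(a)$ for some $a\in A$), and for all $a_0,a_1\in A$, $b\in B$, $f(a_0)+b=f(a_1)$ implies $b\in f[A]$. It is strongly unitary if it is unitary and for all $m\in\mathbb{N}=\{1,2,\dots\}$ and $b\in B$, $mb\in f[A]$ implies $b\in f[A]$. If $A$ is a submonoid of $B$, then $B$ is a unitary (resp. strong unitary) extension of $A$ if the inclusion map is unitary (resp. strongly unitary). An equation system with parameters from $M$ is a finite set of equations, each of the form $\sum_{i<k}p_i\mathbf{x}_i+a=\sum_{i<k}q_i\mathbf{x}_i+b$ with $k,p_i,q_i$ non-negative integers, $a,b\in M$, and $\mathbf{x}_i$ unknowns. A cone $M$ is unitarily closed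 (resp. strongly unitarily closed) if every equation system with parameters from $M$ that has a solution in some unitary (resp. strong unitary) extension of $M$ that is a cone has a solution in $M$. *)

(* Defs.v *)
From Stdlib Require List.
From mathcomp Require Import all_boot all_algebra.

Set Implicit Arguments.
Unset Strict Implicit.
Unset Printing Implicit Defensive.

Import GRing.Theory.
Local Open Scope ring_scope.

Definition alg_le (M : nmodType) (x y : M) : Prop := exists z : M, x + z = y.

Definition is_cone (M : nmodType) : Prop :=
  forall x y : M, x + y = 0 -> x = 0 /\ y = 0.

Definition has_refinement (M : nmodType) : Prop :=
  forall a0 a1 b0 b1 : M, a0 + a1 = b0 + b1 ->
  exists c00 c01 c10 c11 : M,
    [/\ a0 = c00 + c01, a1 = c10 + c11, b0 = c00 + c10 & b1 = c01 + c11].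

Definition refinement_cone (M : nmodType) : Prop :=
  is_cone M /\ has_refinement M.

Definition in_image (A B : Type) (f : A -> B) (b : B) : Prop :=
  exists a : A, f a = b.

Definition unitary (A B : nmodType) (f : {additive A -> B}) : Prop :=
  [/\ injective f,
      forall b : B, exists a : A, alg_le b (f a)
    & forall (a0 a1 : A) (b : B), f a0 + b = f a1 -> in_image f b].

Definition strongly_unitary (A B : nmodType) (f : {additive A -> B}) : Prop :=
  unitary f /\
  forall (m : nat) (b : B), (0 < m)%N -> in_image f (b *+ m) -> in_image f b.

(* The unknowns are indexed by nat and shared by all the equations of a system;
   an equation only involves those of index less than its own eq_arity. *)
Record equation (M : Type) : Type := Equation {
  eq_arity : nat;
  eq_lcoef : 'I_eq_arity -> nat;
  eq_rcoef : 'I_eq_arity -> nat;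
  eq_lparam : M;
  eq_rparam : M
}.

Definition equation_system (M : Type) : Type := seq (equation M).

(* The map f interprets in N the parameters, which are taken from M. *)
Definition satisfies (M : Type) (N : nmodType) (f : M -> N)
    (x : nat -> N) (e : equation M) : Prop :=
  \sum_(i < eq_arity e) x i *+ eq_lcoef i + f (eq_lparam e) =
  \sum_(i < eq_arity e) x i *+ eq_rcoef i + f (eq_rparam e).

Definition has_solution (M : Type) (N : nmodType) (f : M -> N)
    (S : equation_system M) : Prop :=
  exists x : nat -> N, List.Forall (satisfies f x) S.

(* An extension of M is given, up to isomorphism, by an injective homomorphism
   from M to another monoid N. *)
Definition unitarily_closed (M : nmodType) : Prop :=
  forall (S : equation_system M) (N : nmodType) (f : {additive M -> N}),
    is_cone N -> unitary f -> has_solution f S -> has_solution (@id M) S.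

Definition strongly_unitarily_closed (M : nmodType) : Prop :=
  forall (S : equation_system M) (N : nmodType) (f : {additive M -> N}),
    is_cone N -> strongly_unitary f ->
    has_solution f S -> has_solution (@id M) S.

Definition normally_divisible (M : nmodType) : Prop :=
  forall (p : nat) (X : seq M) (a : M), (0 < p)%N ->
  exists u : M, u *+ p = a /\
    forall x y : M, x \in X -> y \in X -> x + a = y + a -> x + u = y + u.

(* Main.v *)
(** Both parts adjoin the required elements to M. Let K be the free commutative
    monoid on the new unknowns and let h : K -> option M be a partial
    homomorphism, defined on those words whose value in M is forced, such that
    h (k + l) is defined iff h l is as soon as h k is defined. The extension
    is the quotient of M * K by the syntactic congruence of
    (m, k) |-> m + h k, which makes its unitarity immediate.

    For refinement of a0 + a1 = b0 + b1 (all four nonzero), K is free on the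
    c_ij, and h is defined on the words having as many letters c00, c11 as
    letters c01, c10: pairing the former with the latter turns the word into a
    sum of a0, a1, b0, b1, and the equality a0 + a1 = b0 + b1 makes this sum
    independent of the pairing. For division of a nonzero a by p, K is free on
    u, and h (k u) = (k / p) a for k divisible by p; here x + u and y + u are
    identified when x + a = y + a, because they only ever get a value in M
    after being completed by a positive multiple of a. *)

Require Import Defs.
From HB Require Import structures.
From mathcomp Require Import all_boot all_algebra.
From mathcomp Require Import boolp.
From mathcomp Require Import zify.

Set Implicit Arguments.
Unset Strict Implicit.
Unset Printing Implicit Defensive.

Import GRing.Theory.
Local Open Scope ring_scope.
Local Open Scope quotient_scope.

(** * Syntactic congruences and their quotient monoids *)

Section SyntacticCongruence.
Variables (W : nmodType) (T : Type) (g : W -> T).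

(** The coarsest congruence on [W] contained in the kernel of [g]. *)
Definition syn_rel (w w' : W) : bool := `[< forall v, g (w + v) = g (w' + v) >].

Lemma syn_relP w w' : reflect (forall v, g (w + v) = g (w' + v)) (syn_rel w w').
Proof. exact: asboolP. Qed.

Lemma syn_rel_equiv : equiv_class_of syn_rel.
Proof.
split=> [w | w w' | w2 w1 w3].
- exact/syn_relP.
- by apply/syn_relP/syn_relP => E v.
- by move=> /syn_relP E1 /syn_relP E2; apply/syn_relP => v; rewrite E1.
Qed.

Canonical syn_equiv := EquivRelPack syn_rel_equiv.

Definition syn_quot := {eq_quot syn_equiv}.
HB.instance Definition _ := Choice.on syn_quot.

Definition syn_pi (w : W) : syn_quot := \pi_{eq_quot syn_equiv} w.

Lemma syn_piP w w' : reflect (syn_pi w = syn_pi w') (syn_rel w w').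
Proof. exact: (@eqmodP W syn_equiv). Qed.

Lemma syn_pi_surj (q : syn_quot) : exists w, q = syn_pi w.
Proof. by exists (repr q); rewrite /syn_pi reprK. Qed.

Definition syn_add (q r : syn_quot) : syn_quot := syn_pi (repr q + repr r).

Lemma syn_addE w w' : syn_add (syn_pi w) (syn_pi w') = syn_pi (w + w').
Proof.
have reprP v : syn_rel (repr (syn_pi v)) v.
  by apply/syn_piP; rewrite /syn_pi reprK.
apply/syn_piP/syn_relP => v.
rewrite -addrA (syn_relP _ _ (reprP w)) addrCA.
by rewrite (syn_relP _ _ (reprP w')) addrCA addrA.
Qed.

Lemma syn_addA : associative syn_add.
Proof.
move=> q r s; case: (syn_pi_surj q) (syn_pi_surj r) (syn_pi_surj s).
by move=> w -> [w' ->] [w'' ->]; rewrite !syn_addE addrA.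
Qed.

Lemma syn_addC : commutative syn_add.
Proof.
move=> q r; case: (syn_pi_surj q) (syn_pi_surj r) => w -> [w' ->].
by rewrite !syn_addE addrC.
Qed.

Lemma syn_add0 : left_id (syn_pi 0) syn_add.
Proof. by move=> q; case: (syn_pi_surj q) => w ->; rewrite syn_addE add0r. Qed.

HB.instance Definition _ := GRing.isNmodule.Build syn_quot
  syn_addA syn_addC syn_add0.

Lemma syn_pi_is_nmod_morphism : nmod_morphism syn_pi.
Proof. by split=> // w w'; rewrite -syn_addE. Qed.

HB.instance Definition _ := GRing.isNmodMorphism.Build W syn_quot syn_pi
  syn_pi_is_nmod_morphism.

End SyntacticCongruence.

(** * The extension of a cone defined by a partial homomorphism *)

Section PartialValuation.
Variables (M K : nmodType) (h : K -> option M).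
Hypotheses (coneM : is_cone M) (coneK : is_cone K).
Hypothesis h0 : h 0 = Some 0.
Hypothesis hD : forall k l m, h k = Some m -> h (k + l) = omap (+%R m) (h l).
Hypothesis h_cofinal : forall k, exists l m, h (k + l) = Some m.
Hypothesis h_conical : forall k, h k = Some 0 -> k = 0.

(* [None] when [h] is undefined, so that the congruence also remembers where [h]
   is defined. *)
Definition ext_val (w : M * K) : option M := omap (+%R w.1) (h w.2).

Definition ext : nmodType := syn_quot ext_val.

Definition ext_in (m : M) : ext := syn_pi ext_val (m, 0).

Definition ext_gen (k : K) : ext := syn_pi ext_val (0, k).

Lemma ext_in_is_nmod_morphism : nmod_morphism ext_in.
Proof.
by split=> [|m n]; rewrite /ext_in ?raddf0 // -raddfD -[in LHS](addr0 0).
Qed.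

HB.instance Definition _ := GRing.isNmodMorphism.Build M ext ext_in
  ext_in_is_nmod_morphism.

Lemma ext_gen_is_nmod_morphism : nmod_morphism ext_gen.
Proof.
by split=> [|k l]; rewrite /ext_gen ?raddf0 // -raddfD -[in LHS](addr0 0).
Qed.

HB.instance Definition _ := GRing.isNmodMorphism.Build K ext ext_gen
  ext_gen_is_nmod_morphism.

Lemma ext_inDgen m k : ext_in m + ext_gen k = syn_pi ext_val (m, k).
Proof.
by rewrite /ext_in /ext_gen -raddfD; congr (syn_pi _ (_, _)); rewrite (addr0, add0r).
Qed.

Lemma ext_surj (q : ext) : exists m k, q = ext_in m + ext_gen k.
Proof.
case: (syn_pi_surj q) => -[m k] ->.
by exists m, k; rewrite ext_inDgen.
Qed.

Lemma ext_val_eq m n k l :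
  ext_in m + ext_gen k = ext_in n + ext_gen l ->
  omap (+%R m) (h k) = omap (+%R n) (h l).
Proof.
rewrite !ext_inDgen => /syn_piP/syn_relP/(_ 0).
by rewrite !addr0.
Qed.

(** Contexts from [K] suffice: the [M]-component of a context is added to both values alike. *)
Lemma ext_eq m n k l :
  (forall j, omap (+%R m) (h (k + j)) = omap (+%R n) (h (l + j))) ->
  ext_in m + ext_gen k = ext_in n + ext_gen l.
Proof.
move=> E; rewrite !ext_inDgen; apply/syn_piP/syn_relP => -[v j].
have shift x y : ext_val ((x, y) + (v, j)) =
    omap (+%R v) (omap (+%R x) (h (y + j))).
  rewrite /ext_val /=; case: (h _) => //= z.
  by rewrite addrA (addrC v).
by rewrite !shift E.
Qed.

Lemma ext_gen_val k m : h k = Some m -> ext_gen k = ext_in m.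
Proof.
move=> hk; suff: ext_in 0 + ext_gen k = ext_in m + ext_gen 0.
  by rewrite !raddf0 add0r addr0.
apply: ext_eq => j; rewrite (hD _ hk) add0r.
by case: (h j) => //= n; rewrite add0r.
Qed.

Lemma ext_unitary : unitary ext_in.
Proof.
split.
- move=> m n E; have := @ext_val_eq m n 0 0.
  by rewrite E h0 /= !addr0 => /(_ erefl) [].
- move=> q; have [m [k ->]] := ext_surj q.
  have [l [n hkl]] := h_cofinal k.
  exists (m + n), (ext_gen l).
  by rewrite -addrA -raddfD /= (ext_gen_val hkl) raddfD.
- move=> m n q; have [x [k ->]] := ext_surj q => E.
  have := @ext_val_eq (m + x) n k 0.
  rewrite raddfD -addrA E raddf0 addr0 h0 => /(_ erefl).
  (* The other side has a value, so [h k] cannot be [None]. *)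
  case hk: (h k) => [y|] // _.
  by exists (x + y); rewrite (ext_gen_val hk) raddfD.
Qed.

Lemma ext_strongly_unitary :
  (forall k n m, (0 < n)%N -> h (k *+ n) = Some m -> exists m', h k = Some m') ->
  strongly_unitary ext_in.
Proof.
move=> h_pure; split; first exact: ext_unitary.
move=> n q n_gt0; have [x [k ->]] := ext_surj q => -[y E].
have := @ext_val_eq (x *+ n) y (k *+ n) 0.
rewrite !raddfMn raddf0 -mulrnDl -E addr0 h0 => /(_ erefl).
case hkn: (h (k *+ n)) => [z|] // _.
have [m' hk] := h_pure _ _ _ n_gt0 hkn.
by exists (x + m'); rewrite (ext_gen_val hk) raddfD.
Qed.

(** A zero sum has value 0, so conicality of [M] kills both [M]-parts and the value of [k + l]; then
    [h_conical] and [coneK] kill the words. *)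
Lemma ext_cone : is_cone ext.
Proof.
move=> q r; have [x [k ->]] := ext_surj q; have [y [l ->]] := ext_surj r.
move=> E; have := @ext_val_eq (x + y) 0 (k + l) 0.
rewrite !raddfD addrACA E !raddf0 add0r h0 => /(_ erefl).
case hkl: (h (k + l)) => [z|] //= [].
rewrite addr0 => /coneM[/coneM[-> ->] z0].
move: hkl; rewrite z0 => /h_conical/coneK[-> ->].
by rewrite !raddf0 addr0.
Qed.

End PartialValuation.

Lemma cone_mulrn_eq0 (M : nmodType) (x : M) n : is_cone M -> x *+ n = 0 -> x = 0 \/ n = 0%N.
Proof.
move=> coneM; case: n => [|n]; first by right.
by rewrite mulrS => /coneM[-> _]; left.
Qed.

(** * Refinement *)

Section Refinement.
Variables (M : nmodType) (a0 a1 b0 b1 : M).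
Hypothesis ab : a0 + a1 = b0 + b1.

(* [(n00, n01, n10, n11)] stands for the formal sum of the [nij * cij]. *)
Definition word : nmodType := (nat * nat * nat * nat)%type.

Definition balanced (w : word) : bool :=
  let: (n00, n01, n10, n11) := w in (n00 + n11 == n01 + n10)%N.

(* The value of a word paired into [s] pairs c00 + c01, [t] pairs c10 + c11,
   [d] pairs c00 + c10 and [e] pairs c01 + c11. *)
Definition matching_sum (s t d e : nat) : M :=
  a0 *+ s + a1 *+ t + (b0 *+ d + b1 *+ e).

(** Pairs within rows greedily; truncated subtraction leaves column pairs of at most one kind. *)
Definition ref_val (w : word) : option M :=
  let: (n00, n01, n10, n11) := w in
  if balanced w then
    Some (matching_sum (minn n00 n01) (minn n10 n11) (n00 - n01) (n01 - n00))
  else None.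

Arguments balanced : simpl never.
Arguments ref_val : simpl never.

(** The two row pairs use the same four letters as the two column pairs; [ab] says that both
    pairings have the same value. *)
Lemma matching_sum_shift s t d e k :
  matching_sum (s + k) (t + k) d e = matching_sum s t (d + k) (e + k).
Proof.
rewrite /matching_sum !mulrnDr (addrACA (a0 *+ s)) (addrACA (b0 *+ d)).
by rewrite -!mulrnDl ab [LHS]addrAC -[LHS]addrA.
Qed.

Lemma ref_val_matching s t d e :
  ref_val ((s + d)%N, (s + e)%N, (t + d)%N, (t + e)%N) = Some (matching_sum s t d e).
Proof.
rewrite /ref_val /balanced; case: eqP => [_|]; last by lia.
(* Trading [minn d e] column pairs of each kind for row pairs gives the greedy pairing. *)
have -> : matching_sum s t d e =
    matching_sum (s + minn d e) (t + minn d e) (d - e) (e - d).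
  by rewrite matching_sum_shift; congr matching_sum; lia.
by congr (Some (matching_sum _ _ _ _)); lia.
Qed.

Lemma ref_valP w m : ref_val w = Some m -> exists s t d e,
  w = ((s + d)%N, (s + e)%N, (t + d)%N, (t + e)%N) /\ m = matching_sum s t d e.
Proof.
rewrite /ref_val /balanced; case: w => [[[n00 n01] n10] n11].
case: eqP => // bal [<-].
exists (minn n00 n01), (minn n10 n11), (n00 - n01)%N, (n01 - n00)%N.
by split=> //; repeat congr (_, _); lia.
Qed.

Lemma ref_valN w : ref_val w = None -> ~~ balanced w.
Proof. by rewrite /ref_val; case: w => [[[n00 n01] n10] n11]; case: balanced. Qed.

Lemma ref_valD w v m :
  ref_val w = Some m -> ref_val (w + v) = omap (+%R m) (ref_val v).
Proof.
move=> /ref_valP[s [t [d [e [-> ->]]]]].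
case hv: (ref_val v) => [n|] /=.
  have [s' [t' [d' [e' [-> ->]]]]] := ref_valP hv.
  have -> : matching_sum s t d e + matching_sum s' t' d' e' =
      matching_sum (s + s') (t + t') (d + d') (e + e').
    by rewrite /matching_sum !mulrnDr addrACA; congr (_ + _); rewrite addrACA.
  rewrite -ref_val_matching; congr (ref_val (_, _, _, _)); exact: addnACA.
move/ref_valN: hv; case: v => [[[n00 n01] n10] n11].
rewrite /ref_val /balanced /= /GRing.add /= => unbal.
by case: eqP => //; lia.
Qed.

Lemma ref_val_cofinal w : exists v m, ref_val (w + v) = Some m.
Proof.
(* Swapping the counts within each row equalizes them in the sum. *)
case: w => [[[n00 n01] n10] n11]; exists (n01, n00, n11, n10).
case hv: (ref_val _) => [m|]; first by exists m.
by move/ref_valN: hv; rewrite /balanced /= /GRing.add /= => /eqP[]; lia.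
Qed.

(* The difference of the degrees in c00, c11 and in c01, c10 is a grading with
   values in the integers, which are torsion-free. *)
Lemma ref_val_pure w n m :
  (0 < n)%N -> ref_val (w *+ n) = Some m -> exists m', ref_val w = Some m'.
Proof.
move=> n_gt0; case hw: (ref_val w) => [m'|]; first by exists m'.
move/ref_valN: hw; case: w => [[[n00 n01] n10] n11] unbal.
have -> : ((n00, n01, n10, n11) : word) *+ n = (n00 * n, n01 * n, n10 * n, n11 * n)%N.
  by elim: n {n_gt0} => [|n IHn]; rewrite ?muln0 // mulrS IHn !mulnS.
rewrite /ref_val /balanced -!mulnDl eqn_pmul2r //.
by move: unbal; rewrite /balanced => /negbTE ->.
Qed.

(** Each of [s], [t], [d], [e] multiplies a nonzero element, hence vanishes. *)
Lemma ref_val_conical w : is_cone M ->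
  a0 <> 0 -> a1 <> 0 -> b0 <> 0 -> b1 <> 0 -> ref_val w = Some 0 -> w = 0.
Proof.
move=> coneM a0N a1N b0N b1N /ref_valP[s [t [d [e [-> /esym]]]]].
move=> /coneM[/coneM[+ +] /coneM[]].
by do 4![move/(cone_mulrn_eq0 coneM) => [|->] //].
Qed.

End Refinement.

Lemma is_cone_nat : is_cone nat.
Proof. by move=> [|m] [|n]. Qed.

Lemma is_cone_prod (M N : nmodType) : is_cone M -> is_cone N -> is_cone (M * N)%type.
Proof.
by move=> coneM coneN [x y] [x' y'] [/coneM[-> ->] /coneN[-> ->]].
Qed.

Lemma In_mem (T : eqType) (s : seq T) x : reflect (List.In x s) (x \in s).
Proof.
elim: s => [|y s IHs] /=; first by right.
rewrite in_cons; apply: (iffP orP) => [[/eqP ->|/IHs]|[->|/IHs]]; by [left|right].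
Qed.

Definition lin_eq (M : Type) (s : seq (nat * nat)) (a b : M) : equation M :=
  @Equation M (size s) (fun i => (nth (0, 0)%N s i).1)
    (fun i => (nth (0, 0)%N s i).2) a b.

Lemma satisfies_lin_eq (M : Type) (N : nmodType) (f : M -> N) x s a b :
  satisfies f x (lin_eq s a b) <->
  \sum_(i < size s) x i *+ (nth (0, 0)%N s i).1 + f a =
  \sum_(i < size s) x i *+ (nth (0, 0)%N s i).2 + f b.
Proof. by []. Qed.

Definition ref_system (M : nmodType) (a0 a1 b0 b1 : M) : equation_system M :=
  [:: lin_eq [:: (1, 0); (1, 0); (0, 0); (0, 0)]%N 0 a0;
      lin_eq [:: (0, 0); (0, 0); (1, 0); (1, 0)]%N 0 a1;
      lin_eq [:: (1, 0); (0, 0); (1, 0); (0, 0)]%N 0 b0;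
      lin_eq [:: (0, 0); (1, 0); (0, 0); (1, 0)]%N 0 b1].

Lemma ref_systemP (M N : nmodType) (f : {additive M -> N}) a0 a1 b0 b1 x :
  List.Forall (satisfies f x) (ref_system a0 a1 b0 b1) <->
  [/\ x 0%N + x 1%N = f a0, x 2%N + x 3%N = f a1,
      x 0%N + x 2%N = f b0 & x 1%N + x 3%N = f b1].
Proof.
rewrite /ref_system !List.Forall_cons_iff.
rewrite !satisfies_lin_eq /= !big_ord_recl !big_ord0 /=.
rewrite !mulr0n !mulr1n !raddf0 !add0r !addr0.
by split=> [[-> [-> [-> [-> _]]]] | [-> -> -> ->]].
Qed.

Lemma closed_refinement (M : nmodType) :
  is_cone M -> strongly_unitarily_closed M -> has_refinement M.
Proof.
move=> coneM closedM a0 a1 b0 b1 ab.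
(* A zero parameter would give some nonzero word the value 0, but then a refinement is immediate. *)
have [a0E|/eqP a0N] := eqVneq a0 0.
  by exists 0, 0, b0, b1; rewrite a0E !add0r -ab a0E add0r.
have [a1E|/eqP a1N] := eqVneq a1 0.
  by exists b0, b1, 0, 0; rewrite a1E !addr0 -ab a1E addr0.
have [b0E|/eqP b0N] := eqVneq b0 0.
  by exists 0, a0, 0, a1; rewrite b0E !add0r ab b0E add0r.
have [b1E|/eqP b1N] := eqVneq b1 0.
  by exists a0, 0, a1, 0; rewrite b1E !addr0 ab b1E addr0.
pose h := ref_val a0 a1 b0 b1.
have h0 : h 0 = Some 0.
  by rewrite -[0 in LHS]/((0 + 0, 0 + 0, 0 + 0, 0 + 0)%N : word)
    /h ref_val_matching // /matching_sum !mulr0n !addr0.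
have hD := @ref_valD _ _ _ _ _ ab.
have h_con w := @ref_val_conical _ _ _ _ _ w coneM a0N a1N b0N b1N.
have cone_word : is_cone word.
  by do 3![apply: is_cone_prod; last exact: is_cone_nat]; exact: is_cone_nat.
have gen s t d e : ext_gen h ((s + d, s + e, t + d, t + e)%N : word) =
    ext_in h (matching_sum a0 a1 b0 b1 s t d e).
  by apply: (ext_gen_val hD); exact: ref_val_matching.
pose c : seq word := [:: (1, 0, 0, 0); (0, 1, 0, 0); (0, 0, 1, 0); (0, 0, 0, 1)]%N.
have [|||x] := closedM (ref_system a0 a1 b0 b1) (ext h) (ext_in h).
- exact: ext_cone.
- apply: ext_strongly_unitary => //; first exact: ref_val_cofinal.
  exact: ref_val_pure.
- exists (fun i => ext_gen h (nth 0 c i)); apply/ref_systemP.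
  rewrite -!raddfD.
  (* Each sum is put in the shape of [gen], with exactly one of [s], [t], [d], [e] equal to 1. *)
  split; [ rewrite -[LHS]/(ext_gen h (1 + 0, 1 + 0, 0 + 0, 0 + 0)%N)
         | rewrite -[LHS]/(ext_gen h (0 + 0, 0 + 0, 1 + 0, 1 + 0)%N)
         | rewrite -[LHS]/(ext_gen h (0 + 1, 0 + 0, 0 + 1, 0 + 0)%N)
         | rewrite -[LHS]/(ext_gen h (0 + 0, 0 + 1, 0 + 0, 0 + 1)%N)];
  by rewrite gen /matching_sum !mulr0n mulr1n !add0r ?addr0.
- move/(ref_systemP idfun) => [E1 E2 E3 E4].
  by exists (x 0%N), (x 1%N), (x 2%N), (x 3%N).
Qed.

(** * Divisibility *)

Section Division.
Variables (M : nmodType) (p : nat) (a : M).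
Hypothesis p_gt0 : (0 < p)%N.

Definition div_val (k : nat) : option M :=
  if (p %| k)%N then Some (a *+ (k %/ p)) else None.

Lemma div_valD k l m :
  div_val k = Some m -> div_val (k + l)%N = omap (+%R m) (div_val l).
Proof.
rewrite /div_val; case: ifP => // pk [<-].
rewrite dvdn_addr //; case: ifP => //= pl.
by rewrite divnDl // mulrnDr.
Qed.

Lemma div_val_cofinal k : exists l m, div_val (k + l)%N = Some m.
Proof.
(* The completed word is [k * p], with quotient [k]. *)
exists (k * p.-1)%N, (a *+ k).
rewrite /div_val -mulnS prednK // dvdn_mull //.
by rewrite mulnK.
Qed.

Lemma div_val_conical k : is_cone M -> a <> 0 -> div_val k = Some 0 -> k = 0.
Proof.
move=> coneM aN; rewrite /div_val; case: ifP => // pk [].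
by move/(cone_mulrn_eq0 coneM) => [//|k0]; rewrite -(divnK pk) k0.
Qed.

Lemma div_val_absorb x y k :
  x + a = y + a -> omap (+%R x) (div_val k.+1) = omap (+%R y) (div_val k.+1).
Proof.
move=> E; rewrite /div_val; case: ifP => // pk /=; congr Some.
have : (0 < k.+1 %/ p)%N by rewrite divn_gt0 // dvdn_leq.
by case: (_ %/ _)%N => // q _; rewrite mulrS !addrA E.
Qed.

End Division.

(** An implication is not an equation, but its premise lies in [M]: only the pairs satisfying it
    contribute an equation. *)
Definition div_system (M : nmodType) (p : nat) (X : seq M) (a : M) :
    equation_system M :=
  lin_eq [:: (p, 0)]%N 0 a ::
  [seq lin_eq [:: (1, 1)]%N xy.1 xy.2
    | xy <- [seq (x, y) | x <- X, y <- X] & xy.1 + a == xy.2 + a].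

Lemma div_systemP (M N : nmodType) (f : {additive M -> N}) p X a (u : nat -> N) :
  List.Forall (satisfies f u) (div_system p X a) <->
  u 0%N *+ p = f a /\
  forall x y, x \in X -> y \in X -> x + a = y + a -> f x + u 0%N = f y + u 0%N.
Proof.
rewrite List.Forall_cons_iff satisfies_lin_eq /= !big_ord1 /=.
rewrite mulr0n raddf0 add0r addr0 List.Forall_map List.Forall_forall.
split=> -[-> H]; split=> //.
  move=> x y xX yX E.
  have /H : List.In (x, y) [seq xy <- [seq (x, y) | x <- X, y <- X]
      | xy.1 + a == xy.2 + a].
    by apply/In_mem; rewrite mem_filter /= E eqxx allpairs_f.
  by rewrite satisfies_lin_eq /= !big_ord1 /= !mulr1n !(addrC (u 0%N)).
move=> [x y] /In_mem; rewrite mem_filter /= => /andP[/eqP E].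
move=> /allpairsP[[x' y'] /= [xX yX [? ?]]]; subst x' y'.
by rewrite satisfies_lin_eq /= !big_ord1 /= !mulr1n !(addrC (u 0%N)) (H _ _ xX yX E).
Qed.

Lemma closed_normally_divisible (M : nmodType) :
  is_cone M -> unitarily_closed M -> normally_divisible M.
Proof.
move=> coneM closedM p X a p_gt0.
have [->|/eqP aN] := eqVneq a 0.
  by exists 0; split=> //; rewrite mul0rn.
pose h := div_val p a.
have h0 : h 0 = Some 0 by rewrite /h /div_val dvdn0 div0n.
have hD := @div_valD _ p a.
have h_con k := @div_val_conical _ p a k coneM aN.
have [|||u] := closedM (div_system p X a) (ext h) (ext_in h).
- exact: (ext_cone coneM is_cone_nat).
(* For [p > 1] this extension is not strongly unitary: [h p] is defined and [h 1] is not. *)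
- by apply: ext_unitary => //; exact: div_val_cofinal.
- exists (fun=> ext_gen h 1%N); apply/div_systemP; split.
    rewrite -raddfMn; apply: (ext_gen_val hD).
    by rewrite /h /div_val -[1 *+ p]/(1 *+ p) natn dvdnn divnn p_gt0.
  move=> x y _ _ E; apply: ext_eq => j.
  (* The word in context is [1 + j], a successor, so [a] is absorbed at least once. *)
  exact: div_val_absorb.
- move/(div_systemP idfun) => [E H].
  by exists (u 0%N).
Qed.

Theorem theorem1p8 :
  (forall M : nmodType,
     is_cone M -> strongly_unitarily_closed M -> refinement_cone M) /\
  (forall M : nmodType,
     is_cone M -> unitarily_closed M -> normally_divisible M).
Proof.
split=> M coneM closedM; last exact: closed_normally_divisible.
by split=> //; exact: closed_refinement.
Qed.
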